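(* For every $q\geq 2$, $$k_{\min}(K_{1,q})=\lceil\log_2 q\rceil+1 .$$ In particular $k_{\min}(K_{1,4})=3<4=n-1=\mathrm{idim}(K_{1,4})$ (where $n=5$ is the number of vertices), and stars realize an exponential gap between $k_{\min}$ and both the dimension $n-1$ and the isometric dimension $\mathrm{idim}$.
   Context: $K_{1,q}$ is the star with $q$ leaves. For a generating set $S\subseteq\mathbb{Z}_2^k\setminus\{0\}$, $\mathrm{Cay}(\mathbb{Z}_2^k,S)$ is the graph on $\mathbb{Z}_2^k$ with edges $\{g,g+s\}$, $s\in S$. $k_{\min}(G)$ is the least $k$ such that the finite connected graph $G$ embeds isometrically (preserving shortest-path distances) into $\mathrm{Cay}(\mathbb{Z}_2^k,S)$ for some such $S$. $\mathrm{idim}(G)$ is the least $k$ such that $G$ embeds isometrically into the hypercube $Q_k=\mathrm{Cay}(\mathbb{Z}_2^k,\{e_1,\dots,e_k\})$. *)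

(* Defs.v *)
From mathcomp Require Import all_boot all_order all_algebra all_fingroup.

Set Implicit Arguments.
Unset Strict Implicit.
Unset Printing Implicit Defensive.

Import GRing.Theory.

Record sgraph := SGraph {
  vertex :> finType;
  adj : rel vertex;
  adj_sym : symmetric adj;
  adj_irr : irreflexive adj }.

Definition least (P : nat -> Prop) (n : nat) : Prop :=
  P n /\ (forall m, P m -> n <= m).

Definition walk (G : sgraph) (x y : G) (n : nat) : Prop :=
  exists p : seq G, [/\ path (@adj G) x p, last x p = y & size p = n].

(* The shortest-path distance as a relation: [gdist x y d] means d(x, y) = d,
   and no d satisfies it when x and y are not connected. *)
Definition gdist (G : sgraph) (x y : G) : nat -> Prop := least (walk x y).

Definition isometric (G H : sgraph) (f : G -> H) : Prop :=
  forall (x y : G) (d : nat), gdist x y d <-> gdist (f x) (f y) d.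

Definition embeds_isometrically (G H : sgraph) : Prop :=
  exists f : G -> H, isometric f.

Section Star.
Variable q : nat.

(* None is the centre, Some i are the leaves. *)
Definition star_adj (x y : option 'I_q) : bool := (x == None) != (y == None).

Lemma star_adj_sym : symmetric star_adj.
Proof. by move=> x y; rewrite /star_adj eq_sym. Qed.

Lemma star_adj_irr : irreflexive star_adj.
Proof. by move=> x; rewrite /star_adj eqxx. Qed.

Definition star : sgraph := SGraph star_adj_sym star_adj_irr.
End Star.

Section Cayley.
Local Open Scope ring_scope.
Variable k : nat.

Definition cayley_adj (S : {set 'rV['Z_2]_k}) (g h : 'rV['Z_2]_k) : bool :=
  [exists s in S, h == g + s].

Lemma addZ2_self (s : 'rV['Z_2]_k) : s + s = 0.
Proof.
apply/rowP=> i; rewrite !mxE; case: (s 0 i) => [[|[|//]] ?]; exact/val_inj.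
Qed.

Lemma cayley_adj_sym S : symmetric (cayley_adj S).
Proof.
suff imp g h : cayley_adj S g h -> cayley_adj S h g.
  by move=> g h; apply/idP/idP; apply: imp.
move=> /exists_inP[s sS /eqP->]; apply/exists_inP; exists s => //.
by rewrite -addrA addZ2_self addr0.
Qed.

Lemma cayley_adj_irr (S : {set 'rV['Z_2]_k}) :
  0 \notin S -> irreflexive (cayley_adj S).
Proof.
move=> S0 g; apply/negbTE/exists_inP=> -[s sS]; rewrite -{1}[g]addr0.
by move/eqP/addrI=> s0; rewrite s0 sS in S0.
Qed.

Definition cayley (S : {set 'rV['Z_2]_k}) (S0 : 0 \notin S) : sgraph :=
  SGraph (@cayley_adj_sym S) (cayley_adj_irr S0).

Definition std_basis : {set 'rV['Z_2]_k} :=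
  [set delta_mx 0 i | i : 'I_k].

Lemma std_basis_nz : 0 \notin std_basis.
Proof.
apply/imsetP=> -[i _ /rowP/(_ i)]; rewrite !mxE !eqxx => /eqP.
by rewrite eq_sym oner_eq0.
Qed.

Definition hypercube : sgraph := cayley std_basis_nz.
End Cayley.

Definition cayley_embeddable (G : sgraph) (k : nat) : Prop :=
  exists (S : {set 'rV['Z_2]_k}) (S0 : (0 : 'rV['Z_2]_k)%R \notin S),
    <<S>>%g = [set: 'rV['Z_2]_k] /\ embeds_isometrically G (cayley S0).

(* [is_kmin G k] means k_min(G) = k and [is_idim G k] means idim(G) = k;
   idim is undefined when G embeds in no hypercube. *)
Definition is_kmin (G : sgraph) : nat -> Prop := least (cayley_embeddable G).

Definition is_idim (G : sgraph) : nat -> Prop :=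
  least (fun k => embeds_isometrically G (hypercube k)).

(* Main.v *)
Require Import Defs.
From mathcomp Require Import all_boot all_order all_algebra all_fingroup.

(** A star has diameter 2, so its isometric embeddings are its embeddings as an
    induced subgraph.  After translating the centre to 0, such an embedding into
    Cay(Z_2^k, S) is a family of q distinct elements t_i of S with t_i + t_j
    never in S.  Then the set A of the t_i and its translate t_0 + A are disjoint,
    so 2q <= 2^k; conversely, if q <= 2^m, any q elements of the set
    S = {x | x_0 = 1} in Z_2^(m+1) will do.  In the hypercube S has only
    k elements, so q <= k, and the basis itself is such a family when k = q. *)

Set Implicit Arguments.
Unset Strict Implicit.
Unset Printing Implicit Defensive.

Import GRing.Theory.

Section Distance.
Variable G : sgraph.
Implicit Types x y z : G.

Lemma gdist_unique x y d e : gdist x y d -> gdist x y e -> d = e.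
Proof.
move=> [wd mind] [we mine]; apply/eqP; rewrite eqn_leq.
by rewrite mind // mine.
Qed.

Lemma walk0 x y : walk x y 0 <-> x = y.
Proof.
split=> [[p [_ <- /size0nil->]] // | ->].
by exists [::].
Qed.

Lemma walk1 x y : walk x y 1 <-> adj x y.
Proof.
split=> [[[|z [|w p]] [] //=] | xy]; first by rewrite andbT => xz <-.
by exists [:: y]; rewrite /= xy.
Qed.

Lemma gdist0 x y : gdist x y 0 <-> x = y.
Proof. by split=> [[/walk0] | /walk0 w]. Qed.

Lemma gdist1 x y : gdist x y 1 <-> adj x y.
Proof.
split=> [[/walk1] // | xy]; split; first exact/walk1.
by case=> // /walk0 eq_xy; rewrite eq_xy adj_irr in xy.
Qed.

Lemma gdist2 x y z :
  x != y -> ~~ adj x y -> adj x z -> adj z y -> gdist x y 2.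
Proof.
move=> neq_xy nadj_xy xz zy; split; first by exists [:: z; y]; rewrite /= xz zy.
case=> [/walk0/eqP|[/walk1|//]]; first by rewrite (negPf neq_xy).
by rewrite (negPf nadj_xy).
Qed.

End Distance.

Lemma isometric_inj (G H : sgraph) (f : G -> H) : isometric f -> injective f.
Proof. by move=> iso_f x y /gdist0/iso_f/gdist0. Qed.

Lemma isometric_mono (G H : sgraph) (f : G -> H) :
  isometric f -> {mono f : x y / adj x y}.
Proof. by move=> iso_f x y; apply/idP/idP=> /gdist1/iso_f/gdist1. Qed.

(** When any two distinct non-adjacent vertices have a common neighbour, distances are 0, 1 or 2
    according to equality and adjacency alone. The image of the common neighbour keeps distance 2
    from growing or becoming undefined in [H]. *)
Lemma induced_isometric (G H : sgraph) (f : G -> H) :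
    (forall x y : G, x != y -> ~~ adj x y -> exists2 z, adj x z & adj z y) ->
  injective f -> {mono f : x y / adj x y} -> isometric f.
Proof.
move=> diam2 inj_f mono_f x y d.
suff [e [gxy gfxy]] : exists e, gdist x y e /\ gdist (f x) (f y) e.
  by split=> gd; [rewrite (gdist_unique gd gxy) | rewrite (gdist_unique gd gfxy)].
have [->|neq_xy] := eqVneq x y; first by exists 0; split; apply/gdist0.
have [xy|nadj_xy] := boolP (adj x y).
  by exists 1; split; apply/gdist1; rewrite ?mono_f.
have [z xz zy] := diam2 x y neq_xy nadj_xy.
exists 2; split; first exact: (gdist2 (z := z)).
by apply: (gdist2 (z := f z)); rewrite ?mono_f // (inj_eq inj_f).
Qed.

Lemma star_diam2 q (x y : star q) :
  x != y -> ~~ adj x y -> exists2 z, adj x z & adj z y.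
Proof. by case: x y => [i|] [j|] // _ _; exists None. Qed.

Lemma card_star q : #|star q| = q.+1.
Proof. by rewrite card_option card_ord. Qed.

Section CayleyStars.
Local Open Scope ring_scope.

(** In characteristic 2 the only element leading from [g] to [h] is [h - g = g + h]. *)
Lemma cayley_adjE k (S : {set 'rV['Z_2]_k}) g h :
  cayley_adj S g h = (g + h \in S).
Proof.
apply/exists_inP/idP => [[s sS /eqP->]|ghS].
  by rewrite addrA addZ2_self add0r.
by exists (g + h); rewrite // addrA addZ2_self add0r.
Qed.

Lemma star_embedsP q k (S : {set 'rV['Z_2]_k}) (S0 : 0 \notin S) :
  embeds_isometrically (star q) (cayley S0) <->
  exists t : 'I_q -> 'rV['Z_2]_k,
    [/\ injective t, forall i, t i \in S & forall i j, t i + t j \notin S].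
Proof.
split=> [[f iso_f] | [t [inj_t tS sum_free]]].
  have inj_f := isometric_inj iso_f.
  have mono_f x y : (f x + f y \in S) = star_adj x y.
    by rewrite -cayley_adjE; apply: (isometric_mono iso_f).
  (* Translation by the image of the centre; it cancels in the sum of two leaves. For [i = j] the
     last condition reads [0 \notin S]. *)
  exists (fun i => f None + f (Some i)); split=> [i j | i | i j].
  - by move/addrI/inj_f=> [].
  - by rewrite mono_f.
  - by rewrite addrACA addZ2_self add0r mono_f.
pose f (x : star q) : cayley S0 := if x is Some i then t i else 0.
have t_neq0 i : t i != 0 by apply: contraNneq (S0) => <-.
exists f; apply: induced_isometric; first exact: star_diam2.
  case=> [i|] [j|] //= /eqP; last by rewrite eq_sym (negPf (t_neq0 j)).
    by move/eqP/inj_t->.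
  by rewrite (negPf (t_neq0 i)).
move=> x y; rewrite /adj /= cayley_adjE.
case: x y => [i|] [j|] /=; rewrite /star_adj /= ?add0r ?addr0 ?tS //.
  exact/negbTE/sum_free.
exact/negbTE.
Qed.

Lemma card_rVZ2 k : #|{: 'rV['Z_2]_k}| = (2 ^ k)%N.
Proof. by rewrite card_mx card_ord mul1n. Qed.

Lemma star_embeds_card q k (S : {set 'rV['Z_2]_k}) (S0 : 0 \notin S) :
  (0 < q)%N -> embeds_isometrically (star q) (cayley S0) -> (q.*2 <= 2 ^ k)%N.
Proof.
case: q => // q _ /star_embedsP[t [inj_t tS sum_free]].
pose A := [set t i | i : 'I_q.+1]; pose B := [set t ord0 + x | x in A].
have cardA : #|A| = q.+1 by rewrite card_imset // card_ord.
have cardB : #|B| = q.+1 by rewrite card_imset //; apply: addrI.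
have disjAB : [disjoint A & B].
  (* A common element [t i = t ord0 + t j] would be a sum of two leaves lying in [S]. *)
  apply/pred0P=> x /=; apply/andP=> -[/imsetP[i _ ->]].
  case/imsetP=> _ /imsetP[j _ ->] eq_t.
  by have := sum_free ord0 j; rewrite -eq_t tS.
rewrite -addnn -{1}cardA -cardB -card_rVZ2.
by have [_] := leq_card_setU A B; rewrite disjAB => /eqP <-; apply: max_card.
Qed.

(** The nontrivial coset of an index-2 subgroup: sum-free, with [2 ^ m] elements. *)
Definition odd_slab m : {set 'rV['Z_2]_m.+1} :=
  [set x : 'rV['Z_2]_m.+1 | x 0 0 == 1].

Lemma odd_slab_nz m : 0 \notin odd_slab m.
Proof. by rewrite inE mxE. Qed.

Lemma odd_slab_add m x y :
  x \in odd_slab m -> y \in odd_slab m -> x + y \notin odd_slab m.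
Proof. by rewrite !inE mxE => /eqP-> /eqP->. Qed.

Lemma odd_slab_gen m : <<odd_slab m>>%g = [set: 'rV['Z_2]_m.+1].
Proof.
apply/eqP; rewrite eqEsubset subsetT; apply/subsetP=> x _.
have [xS|] := boolP (x \in odd_slab m); first exact: mem_gen.
rewrite inE => x0.
have dS : delta_mx 0 0 \in odd_slab m by rewrite inE mxE.
(* A vector with first coordinate 0 is [(x + e_0) + e_0], both terms being in the slab; the group
   product here is addition. *)
rewrite -[x]addr0 -(addZ2_self (delta_mx 0 0)) addrA.
apply: (@groupM _ <<odd_slab m>>%G); apply: mem_gen => //.
rewrite inE !mxE /=; move: x0; case: (x 0 0) => [[|[|//]] ltx2] // _.
Qed.

Lemma odd_slab_embeds q m :
  (q <= 2 ^ m)%N -> embeds_isometrically (star q) (cayley (odd_slab_nz m)).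
Proof.
rewrite -card_rVZ2 => le_q; apply/star_embedsP.
(* The leading 1 places the vector in the slab, and the other [m] coordinates enumerate distinct
   vectors. *)
pose t (i : 'I_q) : 'rV['Z_2]_(1 + m) :=
  row_mx (const_mx 1) (enum_val (widen_ord le_q i)).
have tS i : t i \in odd_slab m.
  have ti0 : t i 0 (lshift m 0) = 1 by rewrite row_mxEl mxE.
  by rewrite inE -ti0; apply/eqP; congr (t i _ _); apply: val_inj.
exists t; split=> // [i j eq_t | i j].
  have [_ /enum_val_inj/(congr1 val)] := @eq_row_mx _ 1 1 m _ _ _ _ eq_t.
  by move=> eq_ij; apply: val_inj.
exact: odd_slab_add.
Qed.

Lemma delta_rV_inj k : injective (fun i : 'I_k => delta_mx 0 i : 'rV['Z_2]_k).
Proof.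
move=> i j /rowP/(_ i); rewrite !mxE !eqxx /=.
by case: (eqVneq i j).
Qed.

Lemma std_basis_embeds k : embeds_isometrically (star k) (hypercube k).
Proof.
apply/star_embedsP; exists (fun i => delta_mx 0 i); split=> [||i j].
- exact: delta_rV_inj.
- by move=> i; apply: imset_f.
have [<-|neq_ij] := eqVneq i j; first by rewrite addZ2_self std_basis_nz.
apply/imsetP=> -[l _ eq_l].
(* Coordinates [i] and [j] of the sum are both 1, but a basis vector has only one nonzero
   coordinate. *)
move/rowP: (eq_l) => /(_ j); move/rowP: eq_l => /(_ i).
rewrite !mxE !eqxx [j == i]eq_sym (negPf neq_ij) /=.
by case: (eqVneq i l) => // <-; rewrite eq_sym (negPf neq_ij).
Qed.

End CayleyStars.

Lemma star_kmin q : 0 < q -> is_kmin (star q) (up_log 2 q).+1.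
Proof.
move=> q_gt0; split.
  exists (odd_slab (up_log 2 q)), (odd_slab_nz _); split.
    exact: odd_slab_gen.
  by apply: odd_slab_embeds; apply: up_logP.
move=> k [S [S0 [_ /(star_embeds_card q_gt0)]]].
(* For [k = 0] the bound would read [2q <= 1]; otherwise a factor 2 cancels. *)
case: k S S0 => [|k] _ _; first by case: q q_gt0.
by rewrite expnS mul2n leq_double; apply: up_log_min.
Qed.

Lemma star_idim q : is_idim (star q) q.
Proof.
split=> [|k /star_embedsP[t [inj_t tS _]]]; first exact: std_basis_embeds.
(* The [q] leaves inject into the basis, itself the image of [k] indices. *)
rewrite -[q]card_ord -(card_imset predT inj_t) -[leqRHS]card_ord.
apply: leq_trans (leq_imset_card _ _); apply/subset_leq_card/subsetP.
by move=> _ /imsetP[i _ ->]; apply: tS.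
Qed.

(* up_log 2 q is the ceiling of log_2 q. *)
Theorem theorem2p37 :
  (forall q : nat, 2 <= q -> is_kmin (star q) (up_log 2 q + 1)) /\
  [/\ is_kmin (star 4) 3, 3 < 4, #|star 4| = 5, 4 = #|star 4| - 1
    & is_idim (star 4) 4] /\
  (forall q : nat, 2 <= q ->
     exists k d : nat,
       [/\ is_kmin (star q) k, is_idim (star q) d, d = #|star q| - 1,
           2 ^ (k - 2) < #|star q| - 1 <= 2 ^ (k - 1)
         & 2 ^ (k - 2) < d <= 2 ^ (k - 1)]).
Proof.
have kmin q : 2 <= q -> is_kmin (star q) (up_log 2 q + 1).
  by move=> q_gt1; rewrite addn1; apply/star_kmin/ltnW.
split=> //; split.
  split=> //; [exact: (kmin 4) | exact: card_star | by rewrite card_star |].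
  exact: star_idim.
move=> q q_gt1; exists (up_log 2 q + 1), q.
(* As [q >= 2] makes [up_log 2 q] positive, the subtraction of 2 is not truncated. *)
have bounds : 2 ^ (up_log 2 q + 1 - 2) < q <= 2 ^ (up_log 2 q + 1 - 1).
  by rewrite addn1 subn2 subn1; apply: up_log_bounds.
by rewrite card_star subn1; split=> //; [apply: kmin | apply: star_idim].
Qed.
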